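(* Let $k\in\{1,\dots,m\}$. Suppose there exists a map $\gamma_k:\Omega\to\mathbb{R}^d$, $\omega\mapsto\gamma_{k,\omega}$, such that $$\sum_{\omega\in\Omega}\gamma_{k,\omega}=g_k\qquad\text{and}\qquad \sum_{\omega\in\Omega}\ \max_{v\in F_\omega(Y_k)} v^\top\gamma_{k,\omega}<0 .$$ Then $$\forall\, x\in Y_k,\ \forall\, v\in F(x),\qquad v^\top g_k<0 .$$
   Context: Setting. $X\subset\mathbb{R}^d$ is a bounded open set, $f:X\to\mathbb{R}^d$ a vector field, and $F$ a set-valued map on $\overline X$ with values subsets of $\mathbb{R}^d$ such that for all $x\in X$, $F(x)$ is compact and convex and $f(x)\in F(x)$. $A\subset X$ is compact; $\overline X$ and $A$ are polytopes (bounded finite unions of polyhedra, not necessarily convex). Tessellation. $Y_1,\dots,Y_m$ are (nonempty) convex polytopes with $\overline{X\setminus A}=\bigcup_{k=1}^m Y_k$ and $\mathrm{int}(Y_k)\cap\mathrm{int}(Y_{k'})=\varnothing$ for $k\neq k'$. The vectors $g_k\in\mathbb{R}^d$ are the slopes of a continuous piecewise affine function $V$ with $V(x)=g_k^\top x+b_k$ on $Y_k$. Localization assumption. There are a finite set $\Omega\subset X$ and a family of set-valued maps $F_\omega$ ($\omega\in\Omega$) on $\overline X$ with values subsets of $\mathbb{R}^d$ such that for all $x$, $F(x)=\bigcap_{\omega\in\Omega}F_\omega(x)$, and such that for every $\omega\in\Omega$ and every $k\in\{1,\dots,m\}$ the set $F_\omega(Y_k):=\bigcup_{x\in Y_k}F_\omega(x)$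 is compact. *)

(* Defs.v *)
From mathcomp Require Import all_boot all_order all_algebra finmap.
From mathcomp Require Import all_classical all_reals all_analysis.

Set Implicit Arguments.
Unset Strict Implicit.
Unset Printing Implicit Defensive.

Import Order.TTheory GRing.Theory Num.Theory.
Import numFieldNormedType.Exports.

Local Open Scope classical_set_scope.
Local Open Scope ring_scope.

Definition dot (R : realType) (d : nat) (u v : 'cV[R]_d) : R :=
  (u^T *m v) 0 0.

Definition polyhedron (R : realType) (d : nat) (P : set 'cV[R]_d) : Prop :=
  exists (p : nat) (M : 'M[R]_(p, d)) (c : 'cV[R]_p),
    P = [set x | forall i, (M *m x) i 0 <= c i 0].

(* Polytopes are not required to be convex. *)
Definition polytope (R : realType) (d : nat) (P : set 'cV[R]_d) : Prop :=
  bounded_set P /\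
  exists (s : nat) (Q : 'I_s -> set 'cV[R]_d),
    (forall i, polyhedron (Q i)) /\ P = \bigcup_i Q i.

Definition convex_polytope (R : realType) (d : nat) (P : set 'cV[R]_d) : Prop :=
  polytope P /\ convex_set P.

Definition setval_image (T U : Type) (G : T -> set U) (Y : set T) : set U :=
  \bigcup_(x in Y) G x.

(* The attained maximum of S, with junk value 0 if S has no greatest element
   (this does not happen when S is compact and nonempty). *)
Definition setmax (R : realType) (S : set R) : R :=
  xget 0 [set m | S m /\ ubound S m].

(* Main.v *)
Require Import Defs.
From mathcomp Require Import all_boot all_order all_algebra finmap.
From mathcomp Require Import all_classical all_reals all_analysis.

Import Order.TTheory GRing.Theory Num.Theory.
Import numFieldNormedType.Exports.

Local Open Scope classical_set_scope.
Local Open Scope ring_scope.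

(** A vector [v] of [F x] lies in every [Floc w x], hence in the image of [Y k] under each [Floc w].
    Since [g k] is the sum of the [gamma w], linearity splits [dot v (g k)] into the terms
    [dot v (gamma w)]. Each is at most the maximum of that linear form over the compact image
    ([setmax_ub], [dot_continuous]), and these maxima have a negative sum. *)

Lemma setmax_ub (R : realType) (T : topologicalType) (h : T -> R) (S : set T) :
  compact S -> continuous h -> forall v, S v -> h v <= setmax (h @` S).
Proof.
move=> S_compact h_cont v Sv.
suff [_] : [set m | (h @` S) m /\ ubound (h @` S) m] (setmax (h @` S)).
  by apply; exists v.
(* The default value 0 of [setmax] is ruled out once some maximum exists; compactness provides one,
   [v] witnessing that [S] is nonempty. *)
apply: xgetPex.
have [||c cS c_max] := @compact_EVT_max T R h S _ S_compact.
- by exists v.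
- exact: continuous_subspaceT.
exists (h c); split; first by exists c => //; exact: set_mem.
by move=> _ [t St <-]; apply/c_max/mem_set.
Qed.

Lemma dot_continuous (R : realType) (d : nat) (w : 'cV[R]_d) :
  continuous (fun v => dot v w).
Proof.
have -> : (fun v => dot v w) = (fun v => \sum_i v i 0 * w i 0).
  by apply: funext => v; rewrite /dot mxE; apply: eq_bigr => i _; rewrite mxE.
move=> v; apply: (@cvg_big _ _ _ _ _ _ _ (nbhs v)) => [|i _].
  exact: add_continuous.
by apply: cvgM; [exact: coord_continuous | exact: cvg_cst].
Qed.

Theorem theorem7 (R : realType) (d : nat)
  (* domain, vector field and set-valued map; maps defined on a subset of
     R^d are total functions constrained only on that subset *)
  (X A : set 'cV[R]_d) (f : 'cV[R]_d -> 'cV[R]_d)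
  (F : 'cV[R]_d -> set 'cV[R]_d)
  (X_open : open X) (X_bounded : bounded_set X)
  (F_compact : forall x, X x -> compact (F x))
  (F_convex : forall x, X x -> convex_set (F x))
  (f_in_F : forall x, X x -> F x (f x))
  (A_sub : A `<=` X) (A_compact : compact A)
  (X_polytope : polytope (closure X)) (A_polytope : polytope A)
  (* tessellation and continuous piecewise affine function *)
  (m : nat) (Y : 'I_m -> set 'cV[R]_d)
  (Y_nonempty : forall k, Y k !=set0)
  (Y_polytope : forall k, convex_polytope (Y k))
  (Y_cover : closure (X `\` A) = \bigcup_k Y k)
  (Y_disjoint : forall k k', k != k' ->
     interior (Y k) `&` interior (Y k') = set0)
  (g : 'I_m -> 'cV[R]_d) (b : 'I_m -> R) (V : 'cV[R]_d -> R)
  (V_continuous : {within closure (X `\` A), continuous V})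
  (V_affine : forall k x, Y k x -> V x = dot (g k) x + b k)
  (* localization *)
  (Omega : {fset 'cV[R]_d})
  (Omega_sub : [set` Omega] `<=` X)
  (Floc : 'cV[R]_d -> 'cV[R]_d -> set 'cV[R]_d)
  (F_inter : forall x, closure X x ->
     F x = \bigcap_(w in [set` Omega]) Floc w x)
  (Floc_compact : forall w k, w \in Omega ->
     compact (setval_image (Floc w) (Y k)))
  (k : 'I_m)
  (gamma_exists : exists gamma : 'cV[R]_d -> 'cV[R]_d,
     \sum_(w <- Omega) gamma w = g k /\
     \sum_(w <- Omega)
       setmax [set dot v (gamma w) | v in setval_image (Floc w) (Y k)] < 0) :
  forall x, Y k x -> forall v, F x v -> dot v (g k) < 0.
Proof.
case: gamma_exists => gamma [<- sum_lt0] x Ykx v Fxv.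
(* [x] may lie on the boundary of [X], so the closure is the right place to use [F_inter]. *)
have Xx : closure X x.
  have : closure (X `\` A) x by rewrite Y_cover; exists k.
  by apply: closure_subset; apply: subDsetl.
have Fw w : w \in Omega -> Floc w x v by move: Fxv; rewrite (F_inter x) //; apply.
apply: le_lt_trans sum_lt0.
(* [big_seq] records [w \in Omega] in both sums, as [Floc_compact] and [Fw] require it. *)
rewrite /dot mulmx_sumr summxE big_seq [leRHS]big_seq.
apply: ler_sum => w w_Omega.
apply: (setmax_ub _ _ (fun v => dot v (gamma w))).
- exact: Floc_compact.
- exact: dot_continuous.
- by exists x => //; exact: Fw.
Qed.
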